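(* Let $K$ be a field, let $I\subset S=K[t_1,\ldots,t_s]$ be an ideal and let $\mathfrak{p}\subset S$ be a prime ideal. If $\mathfrak{p}$ contains all associated primes of $I$, then $IS_{\mathfrak{p}}\cap S=I$.
   Context: $S_{\mathfrak{p}}$ is the localization of $S$ at $\mathfrak{p}$. An associated prime of $I$ is a prime ideal of the form $(I\colon f)$ with $f\in S$. *)

(* Defs.v *)
From HB Require Import structures.
From mathcomp Require Export all_boot all_order all_algebra.
From mathcomp Require Export boolp classical_sets.
From mathcomp Require Export mpoly.

Set Implicit Arguments.
Unset Strict Implicit.
Unset Printing Implicit Defensive.

Import GRing.Theory.

Local Open Scope ring_scope.
Local Open Scope classical_set_scope.

(* [idealr_closed] from ring_quotient is not used: it only describes proper
   ideals with decidable membership, whereas here the unit ideal is an ideal. *)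
Definition is_ideal (R : comNzRingType) (I : set R) : Prop :=
  [/\ I 0,
      forall f g, I f -> I g -> I (f + g) &
      forall a f, I f -> I (a * f)].

Definition is_prime_ideal (R : comNzRingType) (P : set R) : Prop :=
  [/\ is_ideal P,
      ~ P 1 &
      forall f g, P (f * g) -> P f \/ P g].

Definition colon (R : comNzRingType) (I : set R) (f : R) : set R :=
  [set g | I (g * f)].

Definition associated_prime (R : comNzRingType) (I P : set R) : Prop :=
  is_prime_ideal P /\ exists f : R, P = colon I f.

(* Since R is a domain, its localization at a prime ideal P is realized as the
   subring of the fraction field formed by the a / b with b outside P
   (such a b is nonzero, because 0 belongs to P). *)
Definition localization_at (R : idomainType) (P : set R) : set {fraction R} :=
  [set x | exists a b : R, ~ P b /\ x = tofrac a / tofrac b].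

(* The ideal of [localization_at P] generated by the image of I. *)
Definition extended_ideal (R : idomainType) (I P : set R) :
    set {fraction R} :=
  [set x | exists (n : nat) (f : 'I_n -> R) (y : 'I_n -> {fraction R}),
     [/\ forall k, I (f k),
         forall k, localization_at P (y k) &
         x = \sum_(k < n) tofrac (f k) * y k]].

(* J `&` R, for R seen in its fraction field. *)
Definition contraction (R : idomainType) (J : set {fraction R}) : set R :=
  [set f | J (tofrac f)].

(* Main.v *)
Require Import Defs.

(** Clearing denominators, an [f] in the contraction satisfies [f * b \in I]
    for a single [b] outside [p].  So it suffices that for [f] outside [I] the
    proper ideal [(I : f)] lies inside [p], and this holds as soon as [(I : f)]
    lies inside some associated prime of [I]: among the ideals [(I : g)] with
    [g] outside [I] that contain [(I : f)], a maximal one is prime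
    ([maximal_colon_prime]).

    Maximal elements exist because a polynomial ring in finitely many variables
    over a field is Noetherian ([mpoly_maximal_ideal]).  The ascending chain
    condition comes from leading monomials: in a strictly ascending chain
    [J 0, J 1, ...], pick for each [i] an element of [J i.+1] outside [J i] with
    the smallest possible leading monomial.  By Dickson's lemma the leading
    monomial of some pick [f i] divides that of a later pick [f j], and
    subtracting a multiple of [f i] from [f j] gives an element of [J j.+1]
    outside [J j] with a smaller leading monomial than allowed. *)

Set Implicit Arguments.
Unset Strict Implicit.
Unset Printing Implicit Defensive.

Import Order.TTheory GRing.Theory.
Local Open Scope ring_scope.
Local Open Scope classical_set_scope.

(** * Dickson's lemma *)

(** Each value chosen is the smallest one in a tail of the sequence, and the
    tails shrink. *)
Lemma nondecreasing_subsequence (v : nat -> nat) :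
  exists phi : nat -> nat, {homo phi : i j / (i < j)%N} /\
    {homo v \o phi : i j / (i <= j)%N}.
Proof.
have tail_min N : exists i, (N <= i)%N /\ forall j, (N <= j)%N -> (v i <= v j)%N.
  have ex_val : exists x, `[< exists2 i, (N <= i)%N & v i = x >].
    by exists (v N); apply/asboolP; exists N.
  case: (ex_minnP ex_val) => _ /asboolP[i leNi <-] min_i.
  by exists i; split=> // j leNj; apply: min_i; apply/asboolP; exists j.
have [m m_min] := choice tail_min.
pose phi := fix phi k := if k is k'.+1 then m (phi k').+1 else m 0%N.
have phiS k : (phi k < phi k.+1)%N by have [] := m_min (phi k).+1.
exists phi; split; first exact: (homo_ltn ltn_trans phiS).
apply: (homo_leq leqnn leq_trans) => -[|k] /=.
  by have [_ ->] := m_min 0%N.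
have [_ -> //] := m_min (phi k).+1.
exact: ltn_trans (phiS k) (phiS k.+1).
Qed.

Lemma common_nondecreasing_subsequence (T : eqType) (r : seq T)
    (v : T -> nat -> nat) :
  exists phi : nat -> nat, {homo phi : i j / (i < j)%N} /\
    forall t, t \in r -> {homo v t \o phi : i j / (i <= j)%N}.
Proof.
elim: r => [|t r [phi [phi_inc v_phi]]]; first by exists id; split=> [i j|].
have [psi [psi_inc v_psi]] := nondecreasing_subsequence (v t \o phi).
have psi_le : {homo psi : i j / (i <= j)%N}.
  by apply: (homo_leq leqnn leq_trans) => i; apply: ltnW (psi_inc _ _ (ltnSn i)).
exists (phi \o psi); split=> [i j ltij|u]; first exact/phi_inc/psi_inc.
rewrite inE => /predU1P[-> //|u_r] i j leij.
exact: v_phi u_r _ _ (psi_le _ _ leij).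
Qed.

Lemma dickson (n : nat) (m : nat -> 'X_{1..n}) :
  exists i j, (i < j)%N /\ (m i <= m j)%MM.
Proof.
have [phi [phi_inc m_phi]] :=
  common_nondecreasing_subsequence (enum 'I_n) (fun k i => m i k).
exists (phi 0%N), (phi 1%N); split; first exact: phi_inc.
apply/mnm_lepP => k; apply: (m_phi k _ 0%N 1%N) => //.
by rewrite mem_enum.
Qed.

(** * The ascending chain condition for polynomial ideals *)

Lemma idealB (R : comNzRingType) (I : set R) (f g : R) :
  is_ideal I -> I f -> I g -> I (f - g).
Proof. by case=> _ ID IM If Ig; rewrite -mulN1r; apply/ID/IM. Qed.

Lemma ex_min_mlead (K : fieldType) (n : nat) (A : set {mpoly K[n]}) :
  A !=set0 -> exists2 f, A f & forall g, A g -> (mlead f <= mlead g)%O.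
Proof.
case=> f0; move Em: (mlead f0) => m.
elim/(well_founded_induction (@ltom_wf n)): m f0 Em => m IH f mlf Af.
have [f_min|] := pselect (forall g, A g -> (mlead f <= mlead g)%O).
  by exists f.
move/existsNP=> [g /not_implyP[Ag /negP]]; rewrite -ltNge mlf => lt_gf.
exact: (IH _ lt_gf g).
Qed.

(** One step of multivariate division: the multiple of [g] by a single term
    that has the leading term of [f]. *)
Lemma mlead_reduction (K : fieldType) (n : nat) (f g : {mpoly K[n]}) :
    f != 0 -> g != 0 -> (mlead g <= mlead f)%MM ->
  exists q, f - q * g != 0 -> (mlead (f - q * g) < mlead f)%O.
Proof.
move=> f0 g0 le_gf.
pose q : {mpoly K[n]} := (mleadc f / mleadc g) *: 'X_[mlead f - mlead g].
have c0 : mleadc f / mleadc g != 0.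
  by rewrite mulf_neq0 ?invr_eq0 ?mleadc_eq0.
have ml_q : mlead q = (mlead f - mlead g)%MM by rewrite mleadZ ?mleadXm.
have q0 : q != 0.
  by rewrite -mleadc_eq0 ml_q mcoeffZ mcoeffX eqxx mulr1.
have ml_qg : mlead (q * g) = mlead f by rewrite mleadM // ml_q submK.
exists q => r0; rewrite lt_neqAle; apply/andP; split; last first.
  by apply: le_trans (mleadB_le _ _) _; rewrite ml_qg joinxx.
(* The two leading terms cancel. *)
apply: contraNneq r0 => ml_r; rewrite -mleadc_eq0 ml_r mcoeffB subr_eq0.
rewrite -{2}ml_qg mleadM // mleadcM ml_q mcoeffZ mcoeffX eqxx mulr1.
by rewrite divfK // mleadc_eq0.
Qed.

Lemma mpoly_acc (K : fieldType) (n : nat) (J : nat -> set {mpoly K[n]}) :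
    (forall i, is_ideal (J i)) -> (forall i, J i `<=` J i.+1) ->
  exists i, J i.+1 `<=` J i.
Proof.
move=> J_ideal J_asc; apply: contrapT => /forallNP J_strict.
have /choice[f f_min] i : exists f, (J i.+1 `\` J i) f /\
    forall g, (J i.+1 `\` J i) g -> (mlead f <= mlead g)%O.
  have [|f] := @ex_min_mlead K n (J i.+1 `\` J i); last by exists f.
  by have /existsNP[g /not_implyP[]] := J_strict i; exists g.
have J_mono : {homo J : i j / (i <= j)%N >-> i `<=` j}.
  by apply: homo_leq => // [A|A B C]; [exact: subset_refl|exact: subset_trans].
have f0 i : f i != 0.
  have [[_ nJf] _] := f_min i; apply: contra_not_neq nJf => ->.
  by case: (J_ideal i).
have [i [j [ltij le_ij]]] := dickson (fun i => mlead (f i)).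
have [q lt_r] := mlead_reduction (f0 j) (f0 i) le_ij.
have [[Jfi _] _] := f_min i.
have [[Jfj nJfj] min_j] := f_min j.
have Jj_qf : J j (q * f i) by case: (J_ideal j) => _ _; apply; apply: J_mono Jfi.
have nJr : ~ J j (f j - q * f i).
  case: (J_ideal j) => _ JD _ Jr; apply: nJfj.
  by rewrite -[f j](subrK (q * f i)); apply: JD.
have r0 : f j - q * f i != 0.
  by apply: contra_not_neq nJr => ->; case: (J_ideal j).
have := lt_r r0; rewrite ltNge min_j //; split=> //.
by apply: idealB => //; apply: J_asc.
Qed.

Lemma mpoly_maximal_ideal (K : fieldType) (n : nat)
    (F : set (set {mpoly K[n]})) :
    F `<=` @is_ideal _ -> F !=set0 ->
  exists2 M, F M & forall J, F J -> M `<=` J -> J `<=` M.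
Proof.
move=> F_ideal [J0 FJ0]; apply: contrapT => no_max.
have /choice[next nextP] M : exists J, F M -> [/\ F J, M `<=` J & ~ J `<=` M].
  have [FM|nFM] := pselect (F M); last by exists M.
  apply: contrapT => /forallNP noJ; apply: no_max; exists M => // J FJ MJ.
  by apply: contrapT => nJM; apply: (noJ J).
pose J i := iter i next J0.
have FJ i : F (J i) by elim: i => // i /nextP[].
have [i||i] := @mpoly_acc K n J; first exact/F_ideal/FJ.
  by move=> i; have [] := nextP _ (FJ i).
by have [] := nextP _ (FJ i).
Qed.

(** * Colon ideals and associated primes *)

Lemma colon_ideal (R : comNzRingType) (I : set R) (f : R) :
  is_ideal I -> is_ideal (colon I f).
Proof.
case=> I0 ID IM; split=> [|g h Ig Ih|a g Ig]; rewrite /colon /=.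
- by rewrite mul0r.
- by rewrite mulrDl; apply: ID.
- by rewrite -mulrA; apply: IM.
Qed.

Lemma colon_subM (R : comNzRingType) (I : set R) (a f : R) :
  is_ideal I -> colon I f `<=` colon I (a * f).
Proof. by case=> _ _ IM b Ibf; rewrite /colon /= mulrCA; apply: IM. Qed.

(** If [a * b] lies in [(I : f)] and [a] does not, then [b] lies in
    [(I : a * f)], which equals [(I : f)] by maximality. *)
Lemma maximal_colon_prime (R : comNzRingType) (I : set R) (f : R) :
    is_ideal I -> ~ I f ->
    (forall g, ~ I g -> colon I f `<=` colon I g -> colon I g `<=` colon I f) ->
  is_prime_ideal (colon I f).
Proof.
move=> I_ideal nIf f_max; split=> [||a b Iabf]; first exact: colon_ideal.
  by rewrite /colon /= mul1r.
have [Iaf|nIaf] := pselect (colon I f a); [by left | right].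
have sub_f := f_max _ nIaf (colon_subM a I_ideal).
by apply: sub_f; rewrite /colon /= mulrCA mulrA.
Qed.

Lemma colon_sub_associated_prime (K : fieldType) (n : nat)
    (I : set {mpoly K[n]}) (f : {mpoly K[n]}) :
    is_ideal I -> ~ I f ->
  exists2 q, associated_prime I q & colon I f `<=` q.
Proof.
move=> I_ideal nIf.
pose F := [set J | exists g,
  [/\ ~ I g, colon I f `<=` colon I g & J = colon I g]].
have [_ [g [_ _ ->]]||_ [g [nIg fg ->]] g_max] := @mpoly_maximal_ideal K n F.
- exact: colon_ideal.
- by exists (colon I f), f; split=> //; exact: subset_refl.
exists (colon I g) => //; split; last by exists g.
apply: maximal_colon_prime => // h nIh gh; apply: g_max => //.
by exists h; split=> //; apply: subset_trans gh.
Qed.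

(** * Extension to the localization and contraction *)

Lemma notin_prime_neq0 (R : comNzRingType) (P : set R) (b : R) :
  is_prime_ideal P -> ~ P b -> b != 0.
Proof. by case=> -[P0 _ _] _ _; apply: contra_not_neq => ->. Qed.

(** The product of the denominators of the summands is a common denominator,
    and primality of [P] keeps it outside [P]. *)
Lemma extended_idealP (R : idomainType) (I P : set R) (x : {fraction R}) :
    is_ideal I -> is_prime_ideal P -> extended_ideal I P x ->
  exists a b, [/\ I a, ~ P b & x = tofrac a / tofrac b].
Proof.
move=> I_ideal P_prime [n [f [y [If Py ->]]]].
have [I0 ID IM] := I_ideal; have [_ P1 PM] := P_prime.
have F0 b : ~ P b -> tofrac b != 0.
  by move=> /(notin_prime_neq0 P_prime); rewrite tofrac_eq0.
apply: (big_ind (fun z => exists a b,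
  [/\ I a, ~ P b & z = tofrac a / tofrac b])).
- by exists 0, 1; rewrite tofrac0 mul0r.
- move=> _ _ [a [b [Ia nPb ->]]] [c [d [Ic nPd ->]]].
  exists (d * a + b * c), (b * d); split; first by apply: ID; apply: IM.
    by case/PM.
  rewrite addf_div ?F0 // tofracD !tofracM.
  by rewrite (mulrC (tofrac d)) (mulrC (tofrac b) (tofrac c)).
- move=> k _; have [a [b [nPb ->]]] := Py k.
  exists (a * f k), b; split=> //; first exact: IM.
  by rewrite tofracM mulrA (mulrC (tofrac a)).
Qed.

Lemma sub_contraction_extended (R : idomainType) (I P : set R) :
  is_prime_ideal P -> I `<=` contraction (extended_ideal I P).
Proof.
case=> _ P1 _ f If; exists 1%N, (fun=> f), (fun=> 1); split=> //.
  by move=> _; exists 1, 1; rewrite tofrac1 divr1.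
by rewrite big_ord1 mulr1.
Qed.

Theorem proposition3p1 (K : fieldType) (s : nat) (I p : set {mpoly K[s]})
    (I_ideal : is_ideal I) (p_prime : is_prime_ideal p)
    (ass_sub_p : forall q : set {mpoly K[s]},
        associated_prime I q -> q `<=` p) :
  contraction (extended_ideal I p) = I.
Proof.
rewrite eqEsubset; split; last exact: sub_contraction_extended.
move=> f /(extended_idealP I_ideal p_prime)[a [b [Ia npb fE]]].
have Ibf : I (b * f).
  have b0 : tofrac b != 0 by rewrite tofrac_eq0 (notin_prime_neq0 p_prime).
  suff -> : b * f = a by [].
  by apply/eqP; rewrite -tofrac_eq tofracM fE mulrC divfK.
apply: contrapT => nIf.
have [q q_ass fq] := colon_sub_associated_prime I_ideal nIf.
exact/npb/(ass_sub_p q q_ass)/fq.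
Qed.
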